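(* Let $G$ be a subgroup of $\mathbb{Z}^{\mathbb{N}}$. The following conditions are equivalent: (1) $G$ is Hurewicz-bounded. (2) For each strictly increasing $h\in\mathbb{N}^{\mathbb{N}}$ there is $f\in\mathbb{N}^{\mathbb{N}}$ such that for every $g\in G$, for all but finitely many $n$, $|g(k)|\le f(n)$ for all $k\in[0,h(n))$. (3) $G$ is $\le^*$-bounded.
   Context: $\mathbb{N}=\{0,1,2,\dots\}$, and $[0,m)=\{0,1,\dots,m-1\}$. The group $\mathbb{Z}^{\mathbb{N}}$ (the Baer-Specker group) carries pointwise addition and the product topology ($\mathbb{Z}$ discrete); subgroups carry the subspace topology. For $f,g\in\mathbb{N}^{\mathbb{N}}$, $f\le^* g$ means $f(n)\le g(n)$ for all but finitely many $n$. For $g\in\mathbb{Z}^{\mathbb{N}}$, $|g|\in\mathbb{N}^{\mathbb{N}}$ is defined by $|g|(n)=|g(n)|$. A subset $X$ of $\mathbb{Z}^{\mathbb{N}}$ is $\le^*$-bounded if there is $f\in\mathbb{N}^{\mathbb{N}}$ such that $|g|\le^* f$ for each $g\in X$. A topological group $(G,\cdot)$ is Hurewicz-bounded if for each sequence $(U_n)_{n\in\mathbb{N}}$ of neighborhoods of the unit of $G$ there exist finite sets $F_n\subseteq G$, $n\in\mathbb{N}$, such that for each $g\in G$, $g\in F_n\cdot U_n$ for all but finitely many $n$, where $A\cdot B=\{a\cdot b: a\in A,\ b\in B\}$. *)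

(* Defs.v *)
From HB Require Import structures.
From mathcomp Require Import all_boot all_order all_algebra.
From mathcomp Require Import all_classical topology tvs.

Set Implicit Arguments.
Unset Strict Implicit.
Unset Printing Implicit Defensive.

Import GRing.Theory.

Local Open Scope classical_set_scope.
Local Open Scope ring_scope.

(* The library puts no topology on int; make it discrete, as it does for nat. *)
HB.instance Definition _ := hasNbhs.Build int principal_filter.
HB.instance Definition _ := Discrete_ofNbhs.Build int erefl.

(* {ptws nat -> int} is the product of countably many copies of int. *)
Definition baer_specker : Type := {ptws nat -> int}.

HB.instance Definition _ := GRing.Zmodule.copy baer_specker (nat -> int).
HB.instance Definition _ := Topological.copy baer_specker {ptws nat -> int}.

Lemma baer_specker_cvgP (F : set_system baer_specker) (g : baer_specker) :
  Filter F -> F --> g <-> forall k, \forall x \near F, x k = g k.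
Proof.
move=> FF; split=> [Fg k|Fg].
  apply: (Fg [set x | x k = g k]).
  have gk : nbhs (g k) [set g k] by rewrite nbhs_principalE.
  exact: (@proj_continuous nat (fun=> int) k g _ gk).
apply/cvg_sup => k A /= [_ [[B _ <-] Bg] sBA].
apply: filterS (Fg k) => x xk; apply: sBA.
by rewrite /= xk.
Qed.

Lemma baer_specker_sub_continuous :
  continuous (fun x : baer_specker * baer_specker => x.1 - x.2).
Proof.
move=> x; apply/baer_specker_cvgP => k.
have coord (g : baer_specker) : \forall y \near g, y k = g k.
  by have /baer_specker_cvgP/(_ k) : nbhs g --> g by exact: cvg_id.
exists ([set y | y k = x.1 k], [set y | y k = x.2 k]).
  by split; exact: coord.
move=> -[y1 y2] [/= e1 e2].
by rewrite /= -[LHS]/(y1 k - y2 k) -[RHS]/(x.1 k - x.2 k) e1 e2.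
Qed.

HB.instance Definition _ :=
  PreTopologicalNmodule_isTopologicalZmodule.Build baer_specker
    baer_specker_sub_continuous.

Definition subgroup_type (V : zmodType) (G : zmodClosed V) : Type :=
  {x : V | x \in G}.

Section subgroup_zmod.
Variables (V : zmodType) (G : zmodClosed V).

HB.instance Definition _ := SubChoice.on (subgroup_type G).
HB.instance Definition _ := [SubChoice_isSubZmodule of subgroup_type G by <:].

End subgroup_zmod.

Section subgroup_topology.
Variables (V : topologicalZmodType) (G : zmodClosed V).

HB.instance Definition _ := Topological.copy (subgroup_type G)
  (initial_topology (val : subgroup_type G -> V)).

Lemma subgroup_sub_continuous :
  continuous (fun x : subgroup_type G * subgroup_type G => x.1 - x.2).
Proof.
move=> x A [_ [[B oB <-] Bx] sBA].
have val_cont : continuous (val : subgroup_type G -> V).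
  exact: initial_continuous.
have nB : nbhs (val x.1 - val x.2) B.
  by apply: open_nbhs_nbhs; split=> //; rewrite -raddfB.
have [[P Q] [/= nP nQ] sPQ] := @sub_continuous V (val x.1, val x.2) B nB.
exists (val @^-1` P, val @^-1` Q).
  by split; [exact: val_cont nP | exact: val_cont nQ].
move=> -[y1 y2] [/= Py1 Qy2]; apply: sBA.
exact: (sPQ (val y1, val y2)).
Qed.

HB.instance Definition _ :=
  PreTopologicalNmodule_isTopologicalZmodule.Build (subgroup_type G)
    subgroup_sub_continuous.

End subgroup_topology.

(* Topological groups are written additively here, so F_n . U_n is the
   Minkowski sum of F_n and U_n. *)
Definition hurewicz_bounded (G : topologicalZmodType) : Prop :=
  forall U : nat -> set G, (forall n, nbhs (0 : G) (U n)) ->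
  exists2 F : nat -> set G, (forall n, finite_set (F n)) &
    forall g : G, \forall n \near \oo,
      [set a + b | a in F n & b in U n] g.

Definition le_star (f g : nat -> nat) : Prop :=
  \forall n \near \oo, (f n <= g n)%N.

Definition le_star_bounded (X : set baer_specker) : Prop :=
  exists f : nat -> nat, forall g, X g -> le_star (fun n => `|g n|%N) f.

(* Main.v *)
(* A neighborhood of 0 in G contains all members of G that vanish on some
   [0, m).  Hence if G is Hurewicz-bounded, an element of F_n + U_n with
   U_n := {u | u = 0 on [0, h n)} is bounded on [0, h n) by the maximum over
   the finite set F_n.  Conversely, if |g| <=* f then for all large n the bound
   |g k| <= f k + n holds for every k, the n absorbing the finitely many
   exceptional coordinates; on [0, m) only finitely many patterns satisfy this
   bound, and F_n collects one representative in G of each of them. *)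
Require Import Defs.
From mathcomp Require Import all_boot all_order all_algebra.
From mathcomp Require Import all_classical topology tvs.

Import GRing.Theory.

Local Open Scope classical_set_scope.
Local Open Scope ring_scope.

Lemma nbhs0_cylinder (m : nat) :
  nbhs (0 : baer_specker) [set x | forall k, (k < m)%N -> x k = 0].
Proof.
have coord k : nbhs (0 : baer_specker) [set x | x k = 0].
  have cvg0 : nbhs (0 : baer_specker) --> (0 : baer_specker) by exact: cvg_id.
  exact: (iffLR (baer_specker_cvgP _ _) cvg0 k).
(* Indexing by the finite type ['I_m] makes the cylinder a finite intersection of neighborhoods. *)
have fin (i : 'I_m) : nbhs (0 : baer_specker) [set x | x i = 0] by exact: coord.
apply: filterS (filter_forall _ fin) => x x0 k km.
exact: (x0 (Ordinal km)).
Qed.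

(** The filter generated by the cylinders converges to 0 in each coordinate, hence in the product
    topology, so it contains every neighborhood of 0. *)
Lemma nbhs0_sub_cylinder (U : set baer_specker) :
  nbhs (0 : baer_specker) U ->
  exists m, forall x : baer_specker, (forall k, (k < m)%N -> x k = 0) -> U x.
Proof.
pose C m := [set x : baer_specker | forall k, (k < m)%N -> x k = 0].
have FF : Filter (filter_from setT C).
  apply: filter_from_filter; first by exists 0%N.
  move=> i j _ _; exists (maxn i j) => // x x0; split=> k ki; apply: x0.
    by rewrite leq_max ki.
  by rewrite leq_max ki orbT.
have : filter_from setT C --> (0 : baer_specker).
  by apply/baer_specker_cvgP => k; exists k.+1 => // x; apply.
by move=> /[apply] -[m _ sU]; exists m => x x0; exact: sU.
Qed.

Lemma nbhs0_subgroup_cylinder (G : zmodClosed baer_specker) (m : nat) :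
  nbhs (0 : subgroup_type G) [set x | forall k, (k < m)%N -> val x k = 0].
Proof.
have val_cont : continuous (val : subgroup_type G -> baer_specker).
  exact: initial_continuous.
exact: (val_cont 0 _ (nbhs0_cylinder m)).
Qed.

Lemma nbhs0_sub_subgroup_cylinder (G : zmodClosed baer_specker)
    (U : set (subgroup_type G)) :
  nbhs (0 : subgroup_type G) U ->
  exists m, forall x, (forall k, (k < m)%N -> val x k = 0) -> U x.
Proof.
move=> [_ [[B oB <-] B0] sBU].
have /nbhs0_sub_cylinder[m sB] : nbhs (0 : baer_specker) B.
  by apply: open_nbhs_nbhs; split.
by exists m => x x0; apply: sBU; exact: sB.
Qed.

Lemma finite_set_coord_bound (G : zmodClosed baer_specker)
    (F : set (subgroup_type G)) (m : nat) :
  finite_set F ->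
  exists b : nat, forall a, F a -> forall k, (k < m)%N -> (`|val a k| <= b)%N.
Proof.
move=> /finite_seqP[s ->].
exists (\max_(a <- s) \max_(i < m) `|val a i|)%N => a sa k km.
apply: leq_trans (leq_bigmax_seq _ sa _) => //.
exact: (leq_bigmax (Ordinal km)).
Qed.

Lemma finite_representatives (G : zmodClosed baer_specker) (m b : nat) :
  exists2 F : set (subgroup_type G), finite_set F &
    forall g : subgroup_type G,
      (forall k, (k < m)%N -> (`|val g k| <= b)%N) ->
      exists2 a, F a & forall k, (k < m)%N -> val g k = val a k.
Proof.
pose small := [set g : subgroup_type G |
  forall k, (k < m)%N -> (`|val g k| <= b)%N].
(* Sign and absolute value determine an integer, so on [small] the code determines the first [m]
   coordinates. *)
pose code (g : subgroup_type G) : {ffun 'I_m -> bool * 'I_b.+1} :=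
  [ffun i : 'I_m => (0 <= val g i, inord `|val g i|%N)].
(* The default 0 is harmless: [rep] is evaluated only at codes of elements of [small]. *)
pose rep c := xget 0 (small `&` [set g | code g = c]).
exists (range rep); first exact/finite_image/finite_finset.
move=> g g_small; exists (rep (code g)); first by exists (code g).
have [a_small a_code] : (small `&` [set a | code a = code g]) (rep (code g)).
  by apply: (xgetI 0 (x:=g)); split.
move=> k km; have /ffunP/(_ (Ordinal km)) := a_code.
rewrite !ffunE /= => -[sgn /(congr1 val)].
rewrite /= !inordK ?ltnS ?a_small ?g_small // => abs.
by move: sgn abs; case: (val g k) (val (rep (code g)) k) => p [q|q] //= _ [->].
Qed.

Lemma le_star_add_eventually (g : nat -> int) (f : nat -> nat) :
  le_star (fun n => `|g n|%N) f ->
  \forall n \near \oo, forall k, (`|g k| <= f k + n)%N.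
Proof.
(* For [k] at least [N] the term [f k] suffices; below [N], [n] itself dominates. *)
move=> [N _ gf]; exists (\max_(i < N) `|g i|)%N => // n /= leb k.
have [Nk|kN] := leqP N k; first exact: leq_trans (gf k Nk) (leq_addr _ _).
apply: leq_trans (leq_addl _ _); apply: leq_trans leb.
exact: (leq_bigmax (Ordinal kN)).
Qed.

Theorem theorem3p4 (G : zmodClosed baer_specker) :
  [<-> (* (1) *)
       hurewicz_bounded (subgroup_type G);
       (* (2) *)
       forall h : nat -> nat, {homo h : m n / (m < n)%N} ->
         exists f : nat -> nat, forall g : baer_specker, g \in G ->
           \forall n \near \oo, forall k, (k < h n)%N -> (`|g k| <= f n)%N;
       (* (3) *)
       le_star_bounded [set` G]].
Proof.
tfae.
- move=> hG h _.
  have [F finF cover] := hG _ (fun n => nbhs0_subgroup_cylinder G (h n)).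
  have [f fP] := choice (fun n => finite_set_coord_bound G (F n) (h n) (finF n)).
  exists f => g gG; pose x : subgroup_type G := exist _ g gG.
  apply: filterS (cover x) => n [a Fa [u u0 aux]] k kh.
  have -> : g k = val a k.
    by rewrite -[g]/(val x) -aux raddfD -[LHS]/(val a k + val u k) u0 ?addr0.
  exact: fP.
(* Since [n < S n], the choice [h = S] covers the diagonal case [k = n]. *)
- move=> /(_ S) [//|f fP]; exists f => g gG.
  by apply: filterS (fP g gG) => n; apply.
- move=> [f fP] U nU.
  have [m mP] := choice (fun n => nbhs0_sub_subgroup_cylinder G _ (nU n)).
  (* One constant above [f k + n] for all [k < m n]. *)
  pose b n := (\max_(i < m n) f i + n)%N.
  have /choice[F FP] n : exists F : set (subgroup_type G), finite_set F /\
      forall g : subgroup_type G,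
        (forall k, (k < m n)%N -> (`|val g k| <= b n)%N) ->
        exists2 a, F a & forall k, (k < m n)%N -> val g k = val a k.
    by have [F] := finite_representatives G (m n) (b n); exists F.
  exists F => [n|g]; first by case: (FP n).
  apply: filterS (le_star_add_eventually _ _ (fP _ (valP g))) => n gf.
  have [_ /(_ g)[k km|a Fa ga]] := FP n.
    apply: leq_trans (gf k) _; rewrite leq_add2r.
    exact: (leq_bigmax (Ordinal km)).
  (* As [g] and [a] agree on [0, [m n]), their difference lies in [U n]. *)
  exists a => //; exists (g - a); last by rewrite addrC subrK.
  by apply: mP => k km; rewrite raddfB -[LHS]/(val g k - val a k) ga ?subrr.
Qed.
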